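(* For every closed infinite-dimensional linear subspace $Y$ of $\mathbb{R}^\omega$ (with the pointwise topology) there is $x\in Y$ such that $\mathrm{L}_x=\mathbb{R}\cup\{\pm\infty\}$. In particular, $\bigcup_{\kappa\leq\omega}\mathrm{L}(\kappa)$ is not spaceable in $\mathbb{R}^\omega$.
   Context: $\mathbb{R}^\omega$ is the real vector space of all real sequences $x=(x(n))_{n\in\omega}$, $\omega=\{0,1,2,\dots\}$ (also denoting the smallest infinite cardinal), endowed with the pointwise (product) topology. For $x\in\mathbb{R}^\omega$, $\mathrm{L}_x\subseteq\mathbb{R}\cup\{\pm\infty\}$ is the set of accumulation points of $x$: a real $\eta$ is in $\mathrm{L}_x$ if $\{n\in\omega:|x(n)-\eta|<\varepsilon\}$ is infinite for all $\varepsilon>0$, and $+\infty$ (resp. $-\infty$) is in $\mathrm{L}_x$ if some subsequence of $x$ diverges to $+\infty$ (resp. $-\infty$). For a cardinal $\kappa$, $\mathrm{L}(\kappa)=\{x\in\mathbb{R}^\omega: |\mathrm{L}_x|=\kappa\}$. A subset $M$ of a topological vector space $X$ is spaceable in $X$ if $M\cup\{0\}$ contains a closed infinite-dimensional linear subspace of $X$. *)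

(* Defs.v *)
From HB Require Import structures.
From mathcomp Require Import all_boot all_order all_algebra.
From mathcomp Require Import all_classical all_reals.
From mathcomp Require Import topology normedtype sequences.

Set Implicit Arguments.
Unset Strict Implicit.
Unset Printing Implicit Defensive.

Import Order.TTheory GRing.Theory Num.Theory.
Import numFieldNormedType.Exports.

Local Open Scope classical_set_scope.
Local Open Scope card_scope.
Local Open Scope ring_scope.

(* Wrapper around [nat -> R] that carries both the product topology of
   [{ptws nat -> R}] and the pointwise module structure. *)
Definition Romega (R : realType) : Type := {ptws nat -> R}.

HB.instance Definition _ (R : realType) :=
  Topological.copy (Romega R) {ptws nat -> R}.
HB.instance Definition _ (R : realType) :=
  GRing.Lmodule.copy (Romega R) (nat -> R).

Section RomegaTopologicalLmodule.
Variable R : realType.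

Lemma Romega_cvgP (T : Type) (F : set_system T) (g : T -> Romega R)
    (x : Romega R) : Filter F ->
  (g @ F --> x) <-> (forall n, (fun t => g t n) @ F --> x n).
Proof.
by move=> FF; exact: (@pointwise_cvgP nat R (g @ F) x).
Qed.

Let Romega_proj_continuous (n : nat) (x : Romega R) :
  (fun y : Romega R => y n) @ x --> x n.
Proof. by apply: (Romega_cvgP id x (nbhs_filter x)).1; exact: cvg_id. Qed.

Let Romega_add_continuous :
  continuous (fun z : Romega R * Romega R => z.1 + z.2).
Proof.
refine (fun z => (@Romega_cvgP _ (nbhs z)
  (fun w : Romega R * Romega R => w.1 + w.2) (z.1 + z.2) _).2 _) => n.
have h1 : (fun w : Romega R * Romega R => w.1 n) @ z --> z.1 n.
  refine (@cvg_comp _ _ _ (fun w : Romega R * Romega R => w.1)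
    (fun x : Romega R => x n) (nbhs z) (nbhs z.1) _ _
    (@Romega_proj_continuous n _)).
  exact: cvg_fst.
have h2 : (fun w : Romega R * Romega R => w.2 n) @ z --> z.2 n.
  refine (@cvg_comp _ _ _ (fun w : Romega R * Romega R => w.2)
    (fun x : Romega R => x n) (nbhs z) (nbhs z.2) _ _
    (@Romega_proj_continuous n _)).
  exact: cvg_snd.
exact: (cvgD h1 h2).
Qed.

Let Romega_scale_continuous :
  continuous (fun z : R^o * Romega R => z.1 *: z.2).
Proof.
refine (fun z => (@Romega_cvgP _ (nbhs z)
  (fun w : R^o * Romega R => w.1 *: w.2) (z.1 *: z.2) _).2 _) => n.
have h1 : (fun w : R^o * Romega R => w.1 : R) @ z --> (z.1 : R).
  exact: cvg_fst.
have h2 : (fun w : R^o * Romega R => w.2 n) @ z --> z.2 n.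
  refine (@cvg_comp _ _ _ (fun w : R^o * Romega R => w.2)
    (fun x : Romega R => x n) (nbhs z) (nbhs z.2) _ _
    (@Romega_proj_continuous n _)).
  exact: cvg_snd.
exact: (cvgM h1 h2).
Qed.

HB.instance Definition _ :=
  PreTopologicalNmodule_isTopologicalNmodule.Build (Romega R)
    Romega_add_continuous.
HB.instance Definition _ :=
  TopologicalNmodule_isTopologicalLmodule.Build R (Romega R)
    Romega_scale_continuous.

End RomegaTopologicalLmodule.

Definition infinite_dimensional (R : realType) (V : lmodType R) (Y : set V) :=
  ~ exists (n : nat) (v : 'I_n -> V),
      Y = [set \sum_(i < n) a i *: v i | a in [set: 'I_n -> R]].

Definition spaceable (R : realType) (X : topologicalLmodType R) (M : set X) :=
  exists Y : set X,
    [/\ closed Y, submod_closed [in Y], infinite_dimensional Y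
      & Y `<=` M `|` [set 0]].

Definition acc_points (R : realType) (x : Romega R) : set (\bar R) :=
  fun l => match l with
  | eta%:E => forall eps : R, 0 < eps ->
      infinite_set [set n : nat | `|x n - eta| < eps]
  | +oo%E => exists2 f : nat -> nat,
      {homo f : m n / (m < n)%N} & x (f n) @[n --> \oo] --> +oo
  | -oo%E => exists2 f : nat -> nat,
      {homo f : m n / (m < n)%N} & x (f n) @[n --> \oo] --> -oo
  end.

(* A cardinal is represented by any set [kappa] having that cardinality; those
   at most omega are thus exactly the ones represented by sets of type
   [set nat]. *)
Definition Lcard (R : realType) (T : Type) (kappa : set T) : set (Romega R) :=
  [set x | acc_points x #= kappa].
Arguments Lcard R {T} kappa.

(* Main.v *)
(* Since Y is infinite-dimensional, for every N it contains a nonzero sequence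
   vanishing below N: otherwise the first N coordinates would embed Y into R^N.
   Adding multiples of such sequences with N growing, one builds an element of
   Y with prescribed values q k at the terms f k of some increasing sequence:
   every coordinate is eventually constant, so the limit exists and lies in the
   closed set Y. Choosing for q an enumeration of the rationals with infinite
   repetitions makes every open interval contain infinitely many terms. *)
Require Import Defs.
From HB Require Import structures.
From mathcomp Require Import all_boot all_order all_algebra.
From mathcomp Require Import all_classical all_reals.
From mathcomp Require Import topology normedtype sequences.
From mathcomp Require Import lebesgue_measure.
Import Order.TTheory GRing.Theory Num.Theory.
Import numFieldNormedType.Exports.
Local Open Scope classical_set_scope.
Local Open Scope card_scope.
Local Open Scope ring_scope.

Section coordinates.
Variable R : realType.
Implicit Types (Y : set (Romega R)) (x y : Romega R).

Let addE x y n : (x + y) n = x n + y n. Proof. by []. Qed.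
Let scaleE (a : R) x n : (a *: x) n = a * x n. Proof. by []. Qed.

Lemma submod_set0 Y : submod_closed [in Y] -> Y 0.
Proof. by case=> /set_mem. Qed.

Lemma submod_setP Y (a : R) x y :
  submod_closed [in Y] -> Y x -> Y y -> Y (a *: x + y).
Proof. by case=> _ YP /mem_set Yx /mem_set Yy; apply/set_mem/YP. Qed.

(** By contraposition and induction on [N] with [Y] varying: if only 0 vanishes below [N], then [Y]
    is spanned by finitely many vectors. One coordinate is removed at a time by passing to its
    kernel in [Y]. *)
Lemma infinite_dimensional_vanishing Y N :
  submod_closed [in Y] -> infinite_dimensional Y ->
  exists y, [/\ Y y, y != 0 & forall j, (j < N)%N -> y j = 0].
Proof.
move=> Ysub Yinf; apply: contrapT => Yinj; apply: Yinf.
have {}Yinj y : Y y -> (forall j, (j < N)%N -> y j = 0) -> y = 0.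
  by move=> Yy y0; apply: contrapT => /eqP yN0; apply: Yinj; exists y.
elim: N => [|N IHN] in Y Ysub Yinj *.
  exists 0%N, (fun=> 0); apply/seteqP; split=> [y Yy|_ [a _ <-]].
    by exists (fun=> 0) => //; rewrite big_ord0 (Yinj y).
  by rewrite big_ord0; exact: submod_set0.
pose Z := Y `&` [set y | y N = 0].
have [||n [v ZE]] := IHN Z.
- split; first by apply/mem_set; split=> //; exact: submod_set0.
  move=> a x y /set_mem[Yx x0] /set_mem[Yy y0]; apply/mem_set.
  split; first exact: submod_setP.
  by rewrite /= addE scaleE x0 y0 mulr0 addr0.
- move=> y [Yy yN] y0; apply: Yinj => // j.
  by rewrite ltnS leq_eqVlt => /predU1P[->//|]; exact: y0.
have [YZ|/existsNP[y /not_implyP[Yy yN]]] := pselect (Y `<=` [set y | y N = 0]).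
  by exists n, v; rewrite -ZE /Z setIidl.
exists n.+1, (fun i => if unlift ord0 i is Some j then v j else y).
have sumE a : \sum_(i < n.+1)
    a i *: (if unlift ord0 i is Some j then v j else y) =
    a ord0 *: y + \sum_(i < n) a (lift ord0 i) *: v i.
  rewrite big_ord_recl unlift_none; congr (_ + _).
  by apply: eq_bigr => i _; rewrite liftK.
apply/seteqP; split=> [x Yx|_ [a _ <-]]; last first.
  rewrite sumE; apply: submod_setP => //.
  suff [] : Z (\sum_(i < n) a (lift ord0 i) *: v i) by [].
  by rewrite ZE; exists (fun i => a (lift ord0 i)).
(* Subtracting the multiple of [y] that cancels coordinate [N] lands in [Z], so [y] and the [v i]
   together span [Y]. *)
have : Z (- (x N / y N) *: y + x).
  split; first exact: submod_setP.
  by rewrite /= addE scaleE mulNr divfK ?addNr//; apply/eqP.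
rewrite ZE => -[a _ aE].
exists (fun i => if unlift ord0 i is Some j then a j else x N / y N) => //.
rewrite sumE unlift_none; under eq_bigr do rewrite liftK.
by rewrite aE scaleNr addrA subrr add0r.
Qed.

Lemma closed_submod_interpolation Y (q : nat -> R) :
  closed Y -> submod_closed [in Y] -> infinite_dimensional Y ->
  exists2 x, Y x &
    exists2 f : nat -> nat, {homo f : m n / (m < n)%N} & forall k, x (f k) = q k.
Proof.
move=> Ycl Ysub Yinf.
have /choice[step stepP] (p : nat * (Romega R * nat)) :
    exists r : Romega R * nat, Y p.2.1 ->
    [/\ Y r.1, (p.2.2 <= r.2)%N, forall j, (j < p.2.2)%N -> r.1 j = p.2.1 j
      & r.1 r.2 = q p.1].
  have [y [Yy yN0 y0]] := infinite_dimensional_vanishing Y p.2.2 Ysub Yinf.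
  have /existsNP[n /eqP yn] : ~ forall n, y n = 0.
    by move=> yn; move/eqP: yN0; apply; apply/funext.
  (* The coefficient moves coordinate [n] to [q p.1]; coordinates below [p.2.2] stay fixed since [y]
     vanishes there. *)
  exists (((q p.1 - p.2.1 n) / y n) *: y + p.2.1, n) => Yp; split => /=.
  - exact: submod_setP.
  - by rewrite leqNgt; apply: contra yn => /y0 ->.
  - by move=> j /y0 yj; rewrite addE scaleE yj mulr0 add0r.
  - by rewrite addE scaleE divfK// subrK.
(* [s k] is the k-th partial sum, whose coordinates below [N k] are final. *)
pose st := fix st k := if k is k'.+1 then
  let r := step (k', st k') in (r.1, r.2.+1) else (0 : Romega R, 0%N).
pose s k := (st k).1; pose N k := (st k).2; pose f k := (N k.+1).-1.
have Ys k : Y (s k).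
  elim: k => [|k IHk]; first exact: submod_set0.
  by have [] := stepP (k, st k) IHk.
have Nf k : (N k <= f k)%N by have [] := stepP (k, st k) (Ys k).
have fN k : (f k < N k.+1)%N by [].
have sS k j : (j < N k)%N -> s k.+1 j = s k j.
  by have [_ _ + _] := stepP (k, st k) (Ys k); exact.
have sf k : s k.+1 (f k) = q k by have [] := stepP (k, st k) (Ys k).
have Nle : {homo N : m n / (m <= n)%N}.
  apply: homo_leq => // [? ? ?|k]; first exact: leq_trans.
  by rewrite ltnW ?(leq_ltn_trans (Nf k)).
have Nge k : (k <= N k)%N.
  by elim: k => // k IHk; rewrite (leq_ltn_trans IHk)// (leq_ltn_trans (Nf k)).
have s_cst k m j : (k <= m)%N -> (j < N k)%N -> s m j = s k j.
  move=> /subnK <- jN; elim: (m - k)%N => // d IHd.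
  by rewrite addSn sS// (leq_trans jN)// Nle// leq_addl.
(* Coordinate [n] is final from stage [n.+1] on, because [n < n.+1 <= N n.+1]. *)
pose x : Romega R := fun n => s n.+1 n.
exists x.
  apply: (closed_cvg (u_ := s) (F := \oo) Y Ycl); first exact: nearW.
  apply/Romega_cvgP => n; apply: cvg_near_cst.
  by exists n.+1 => // m /= nm; rewrite (s_cst n.+1) ?Nge.
exists f => [|k].
  by apply: homo_ltn => [? ? ?|k]; [exact: ltn_trans|exact: leq_trans (Nf _)].
by rewrite -sf /x (s_cst k.+1)// ltnS (leq_trans (Nge k)).
Qed.

Lemma unbounded_subsequence x :
  (forall A : R, infinite_set [set n | A < x n]) ->
  exists2 f : nat -> nat,
    {homo f : m n / (m < n)%N} & x (f n) @[n --> \oo] --> +oo.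
Proof.
(* The previous index doubles as the lower bound for the next value, so growing indices force
   divergence. *)
move=> xoo; have [n|f [_ fS]] :=
    @dependent_choice _ (fun n m => (n < m)%N /\ n%:R < x m) _ 0%N.
  apply/cid; have : infinite_set ([set m | n%:R < x m] `\` `I_n.+1).
    exact: infinite_setD.
  by move=> /infinite_setN0[m [xm /negP]]; rewrite -leqNgt => nm; exists m.
have f_lt : {homo f : m n / (m < n)%N}.
  by apply: homo_ltn => [? ? ?|k]; [exact: ltn_trans|case: (fS k)].
have f_ge k : (k <= f k)%N.
  by elim: k => // k /leq_ltn_trans; apply; exact: f_lt.
(* The starting index [f 0] carries no bound on [x], hence the shift. *)
exists (f \o S) => [m n mn|]; first exact: f_lt.
apply/cvgryPge => A; exists (Num.truncn A).+1 => // n /= An.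
have [_ /ltW] := fS n; apply: le_trans.
rewrite (le_trans (ltW (truncnS_gt A)))// ler_nat.
exact: leq_trans (f_ge n).
Qed.

Lemma acc_pointsT x :
  (forall a b : R, a < b -> infinite_set [set n | a < x n < b]) ->
  acc_points x = [set: \bar R].
Proof.
move=> xab; apply/seteqP; split=> // -[eta| |] _ /=.
- move=> eps eps0; have /xab : eta - eps < eta + eps by rewrite ltrD2l gt0_cp.
  by apply: sub_infinite_set => n /=; rewrite ltr_distl.
- apply: unbounded_subsequence => A; have /xab : A < A + 1 by rewrite ltrDl.
  by apply: sub_infinite_set => n /= /andP[].
- have [|f f_lt fy] := unbounded_subsequence (- x).
    move=> A; have /xab : - A - 1 < - A by rewrite ltrBlDr ltrDl.
    by apply: sub_infinite_set => n /= /andP[_]; rewrite ltrNr.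
  by exists f => //; apply/cvgNry.
Qed.

Lemma closed_submod_acc_pointsT Y :
  closed Y -> submod_closed [in Y] -> infinite_dimensional Y ->
  exists2 x, Y x & acc_points x = [set: \bar R].
Proof.
move=> Ycl Ysub Yinf.
(* The second component of the pair makes every rational recur infinitely often; numbers coding no
   pair get the filler 0. *)
pose q n : R := if @unpickle (rat * nat)%type n is Some p then ratr p.1 else 0.
have [x Yx [f f_lt xf]] := closed_submod_interpolation Y q Ycl Ysub Yinf.
exists x => //; apply: acc_pointsT => a b ab.
have [r] := rat_in_itvoo ab; rewrite in_itv/= => rab.
pose g (m : nat) := f (pickle (r, m)).
have g_inj : injective g.
  by move=> m n /(incn_inj (leq_mono f_lt))/(pcan_inj pickleK)[].
apply: (@sub_infinite_set _ (range g)).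
  by move=> _ [m _ <-] /=; rewrite xf /q pickleK.
by apply/infiniteP; rewrite (card_le_eqr (inj_card_eq (in2W g_inj))).
Qed.

End coordinates.

(** Otherwise the unit interval would be countable, hence of Lebesgue measure 0 instead of 1. *)
Lemma uncountable_ereal (R : realType) : ~ countable [set: \bar R].
Proof.
move=> Tcount; have : countable `[0 : R, 1].
  apply/countable_injP; move/countable_injP : Tcount => [f f_inj].
  by exists (f \o EFin) => a b _ _ /f_inj; rewrite !in_setT => /(_ isT isT)[].
move=> /countable_lebesgue_measure0; rewrite lebesgue_measure_itv/= lte01 sube0.
by move=> /eqP; rewrite onee_eq0.
Qed.

Theorem theorem6p1 (R : realType) :
  (forall Y : set (Romega R),
     closed Y -> submod_closed [in Y] -> infinite_dimensional Y ->
     exists2 x : Romega R, Y x & acc_points x = [set: \bar R])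
  /\ ~ spaceable (\bigcup_(kappa in [set kappa : set nat | kappa #<= [set: nat]])
                    Lcard R kappa).
Proof.
split=> [Y|[Y [Ycl Ysub Yinf YM]]]; first exact: closed_submod_acc_pointsT.
have [x /YM Mx xT] := closed_submod_acc_pointsT R Y Ycl Ysub Yinf.
case: Mx => [[kappa kappa_nat]|x0]; rewrite /Lcard/=.
  rewrite xT => /card_eqPle[Tk _]; apply: (@uncountable_ereal R).
  exact: card_le_trans Tk kappa_nat.
(* The zero sequence is excluded as well: it stays at distance 1 from 1. *)
have : acc_points x 1%:E by rewrite xT.
move=> /(_ 1 ltr01)/infinite_setN0[n] /=.
by rewrite x0 sub0r normrN normr1 ltxx.
Qed.
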